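(* An $(n-\nu,\nu)$-spacetime with index $0<\nu\le n$ admits a conformally invariant continuous proper cone structure $(M,C)$.
   Context: Manifolds are smooth, paracompact, Hausdorff, connected, finite-dimensional, and without boundary. An $(n-\nu,\nu)$-spacetime $(M,g,X)$ is an $n$-dimensional manifold $M$ with a semi-Riemannian metric $g$ of constant index $\nu$ ($0\le\nu\le n$; the index is the maximal dimension of a subspace of $T_pM$ on which $g_p$ is negative definite) together with a fixed set $X=\{X_1,\dots,X_\nu\}$ of continuous vector fields that at each $p\in M$ span a negative definite $\nu$-dimensional subspace of $T_pM$. A convex cone in a finite-dimensional real vector space $V$ is a convex subset $C\subseteq V\setminus\{0\}$ with $sv\in C$ for all $v\in C$, $s>0$; it is sharp if $C\cup\{0\}$ contains no line through the origin, and closed if it is closed in $V\setminus\{0\}$. A cone structure $(M,C)$ is a multivalued map $p\mapsto C_p\subseteq T_pM\setminus\{0\}$ with each $C_p$ a nonempty closed sharp convex cone. It is a closed cone structure if $C=\bigcup_p C_p$ is a closed subbundle of the tangent bundle with the zero section removed. It is a proper cone structure if it is a closed cone structure and $(\operatorname{int}C)_p:=(\operatorname{int} C)\cap T_pM\neq\emptyset$ for every $p\in M$, where $\operatorname{int}C$ is the interior of $C$ in $TM$. A cone structure is continuous if in local coordinates (identifying the tangent spaces over a chart domain with $\mathbb{R}^n$) the set-valued map $F(p)=[C_p\cup\{0\}]\cap\mathbb{B}^n$, with $\mathbb{B}^n$ the closed unit ball of $\mathbb{R}^n$, is both upper semicontinuous (for every $p_0$ and every neighborhood $V$ of $F(p_0)$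 there is a neighborhood $U_0$ of $p_0$ with $F(U_0)\subseteq V$) and lower semicontinuous (for every $p_k\to p_0$ and $y_0\in F(p_0)$ there are $y_k\in F(p_k)$ with $y_k\to y_0$). Conformally invariant means that the cone structure associated to the spacetime depends on the metric $g$ only through its conformal class. *)

(* Defs.v *)
From HB Require Import structures.
From mathcomp Require Import all_boot all_order all_algebra finmap.
From mathcomp Require Import all_classical all_reals all_analysis.

Set Implicit Arguments.
Unset Strict Implicit.
Unset Printing Implicit Defensive.

Import Order.TTheory GRing.Theory Num.Theory.
Import numFieldNormedType.Exports.

Local Open Scope classical_set_scope.
Local Open Scope ring_scope.

(* Iterated Frechet differentials, evaluated at fixed vectors: on an open set
   of R^n this is the usual class C^k. *)
Fixpoint Ck_on (R : realType) n (W : normedModType R) (k : nat)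
    (U : set 'rV[R]_n) (f : 'rV[R]_n -> W) : Prop :=
  if k is k'.+1 then
    (forall x, U x -> differentiable f x) /\
    (forall v, Ck_on k' U (fun x => 'd f x v))
  else forall x, U x -> {for x, continuous f}.

Definition smooth_on (R : realType) n (W : normedModType R)
    (U : set 'rV[R]_n) (f : 'rV[R]_n -> W) := forall k, Ck_on k U f.

Definition paracompact (T : topologicalType) :=
  forall U : set (set T), (forall A, U A -> open A) ->
    \bigcup_(A in U) A = setT ->
  exists V : set (set T),
    [/\ forall B, V B -> open B,
        \bigcup_(B in V) B = setT,
        forall B, V B -> exists2 A, U A & B `<=` A &
        forall x : T, exists2 N, nbhs x N &
          finite_set [set B | V B /\ B `&` N !=set0]].

(* [cmap] and [cinv] are only meaningful on [cdom] and [cmap @` cdom]. *)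
Record chart (R : realType) (n : nat) (T : topologicalType) := Chart {
  cdom : set T;
  cmap : T -> 'rV[R]_n;
  cinv : 'rV[R]_n -> T;
  cdom_open : open cdom;
  cimg_open : open (cmap @` cdom);
  cmap_continuous : {within cdom, continuous cmap};
  cinv_continuous : {within cmap @` cdom, continuous cinv};
  cmapK : {in cdom, cancel cmap cinv} }.

Definition transition (R : realType) (n : nat) (T : topologicalType)
  (c d : chart R n T) : 'rV[R]_n -> 'rV[R]_n := cmap d \o cinv c.

(* The atlas need not be maximal; a maximal one is allowed. *)
Record manifold (R : realType) (n : nat) := Manifold {
  carrier :> topologicalType;
  atlas : set (chart R n carrier);
  atlas_cover : forall p, exists2 c, atlas c & cdom c p;
  atlas_smooth : forall c d, atlas c -> atlas d ->
    smooth_on (cmap c @` (cdom c `&` cdom d)) (transition c d);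
  manifold_hausdorff : hausdorff_space carrier;
  manifold_paracompact : paracompact carrier;
  manifold_connected : connected [set: carrier] }.

Definition mchart (R : realType) n (M : manifold R n) := chart R n M.

Definition chart_at (R : realType) n (M : manifold R n) (c : mchart M) (p : M) :=
  atlas c /\ cdom c p.

Definition smooth_fun (R : realType) n (M : manifold R n) (f : M -> R) :=
  forall c : mchart M, atlas c ->
    smooth_on (cmap c @` cdom c) (f \o cinv c : 'rV[R]_n -> R^o).

(* A tangent vector at p is the family of its components in all the charts
   around p, transforming by the differentials of the transition maps; the
   components in the other charts are set to 0 to make the family unique. *)
Definition tangent_family (R : realType) n (M : manifold R n) (p : M)
    (v : mchart M -> 'rV[R]_n) : Prop :=
  (forall c, ~ chart_at c p -> v c = 0) /\
  (forall c d, chart_at c p -> chart_at d p ->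
     v d = 'd (transition c d) (cmap c p) (v c)).

Definition tangent_pred (R : realType) n (M : manifold R n) (p : M) :
    {pred (mchart M -> 'rV[R]_n)} := fun v => `[< tangent_family p v >].

Record tangent (R : realType) n (M : manifold R n) (p : M) := Tangent {
  tfam : mchart M -> 'rV[R]_n;
  tfamP : tfam \in tangent_pred p }.

Section TangentModule.
Variables (R : realType) (n : nat) (M : manifold R n) (p : M).

Fact tangent_submod : submod_closed (tangent_pred p).
Proof.
split.
  apply/asboolP; split=> // c d _ _.
  by rewrite [X in 'd _ _ X](_ : _ = 0) // linear0.
move=> a u v /asboolP[u0 uJ] /asboolP[v0 vJ]; apply/asboolP; split.
  by move=> c cp; rewrite /= !fctE u0 // v0 // scaler0 addr0.
move=> c d cp dp; transitivity (a *: u d + v d) => //.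
by rewrite (uJ c d) // (vJ c d) // -linearP.
Qed.

HB.instance Definition _ :=
  GRing.isSubmodClosed.Build R (mchart M -> 'rV[R]_n) (tangent_pred p)
    tangent_submod.
HB.instance Definition _ := [isSub for @tfam R n M p].
HB.instance Definition _ := [Choice of tangent p by <:].
HB.instance Definition _ := [SubChoice_isSubLmodule of tangent p by <:].

End TangentModule.

Definition tcoord (R : realType) n (M : manifold R n) (p : M) (c : mchart M)
  (v : tangent p) : 'rV[R]_n := tfam v c.

Section TangentVect.
Variables (R : realType) (n : nat) (M : manifold R n).
Implicit Types (p : M) (c d e : mchart M).

Lemma near_chart c d p : chart_at c p -> chart_at d p ->
  nbhs (cmap c p) (cmap c @` (cdom c `&` cdom d)).
Proof.
move=> [ca cp] [da dp].
have img : (cmap c @` cdom c) (cmap c p) by exists p.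
have nimg : nbhs (cmap c p) (cmap c @` cdom c).
  by apply: open_nbhs_nbhs; split => //; exact: cimg_open.
have cic : {for cmap c p, continuous (cinv c)}.
  have := @cinv_continuous _ _ _ c.
  rewrite continuous_open_subspace; last exact: cimg_open.
  by move=> /(_ (cmap c p)); apply; rewrite inE.
have nd : nbhs (cmap c p) (cinv c @^-1` cdom d).
  apply: cic; rewrite cmapK ?inE//.
  by apply: open_nbhs_nbhs; split => //; exact: cdom_open.
apply: filterS (filterI nimg nd) => x [[q cq <-]] /=.
by rewrite cmapK ?inE// => dq; exists q.
Qed.

Lemma transition_diff c d p : chart_at c p -> chart_at d p ->
  differentiable (transition c d) (cmap c p).
Proof.
move=> [ca cp] [da dp]; have [+ _] := atlas_smooth ca da 1%N.
by apply; exists p.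
Qed.

Lemma transition_id c p v : chart_at c p ->
  'd (transition c c) (cmap c p) v = v.
Proof.
move=> cp; rewrite -deriveE; last exact: transition_diff.
rewrite (@near_eq_derive _ _ _ _ id) ?derive_id//.
apply: filterS (near_chart cp cp) => _ [q [cq _] <-].
by rewrite /transition /= cmapK ?inE.
Qed.

Lemma transition_comp c d e p v :
    chart_at c p -> chart_at d p -> chart_at e p ->
  'd (transition c e) (cmap c p) v =
  'd (transition d e) (cmap d p) ('d (transition c d) (cmap c p) v).
Proof.
move=> cp dp ep.
have cdp : transition c d (cmap c p) = cmap d p.
  by rewrite /transition /= cmapK ?inE//; case: cp.
have dif : differentiable (transition d e) (transition c d (cmap c p)).
  by rewrite cdp; exact: transition_diff.
have eqc : \forall x \near cmap c p,
    transition c e x = (transition d e \o transition c d) x.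
  apply: filterS (near_chart cp dp) => _ [q [cq dq] <-].
  by rewrite /transition /= !cmapK ?inE.
have dif2 := differentiable_comp (transition_diff cp dp) dif.
transitivity ('D_v (transition c e) (cmap c p)).
  by rewrite (deriveE v (transition_diff cp ep)).
rewrite (near_eq_derive v eqc) (deriveE v dif2).
have /(congr1 (@^~ v)) /= := diff_comp (transition_diff cp dp) dif.
by rewrite -cdp.
Qed.

Definition some_chart p : mchart M := projT1 (cid2 (atlas_cover p)).

Lemma some_chartP p : chart_at (some_chart p) p.
Proof. by rewrite /some_chart; case: cid2. Qed.

Definition tangent_ext p c (w : 'rV[R]_n) : mchart M -> 'rV[R]_n :=
  fun d => if `[< chart_at d p >] then 'd (transition c d) (cmap c p) w else 0.

Lemma tangent_extP p c w : chart_at c p -> tangent_ext p c w \in tangent_pred p.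
Proof.
move=> cp; apply/asboolP; split=> [d /asboolPn/negbTE|d e dp ep].
  by rewrite /tangent_ext => ->.
by rewrite /tangent_ext !asboolT//; exact: transition_comp.
Qed.

Lemma tcoord_linear p c : linear (@tcoord R n M p c).
Proof. by []. Qed.

HB.instance Definition _ p c := GRing.isLinear.Build R (tangent p) 'rV[R]_n _
  (@tcoord R n M p c) (@tcoord_linear p c).

Lemma tcoord_transition p c d (v : tangent p) :
  chart_at c p -> chart_at d p ->
  tcoord d v = 'd (transition c d) (cmap c p) (tcoord c v).
Proof. by move=> cp dp; have /asboolP[_] := tfamP v; apply. Qed.

Lemma tcoord_inj p c : chart_at c p -> injective (@tcoord R n M p c).
Proof.
move=> cp u v uv; apply: val_inj; apply/funext => d /=.
have [dp|dp] := pselect (chart_at d p).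
  by rewrite -!/(tcoord d _) !(tcoord_transition _ cp dp) uv.
have /asboolP[u0 _] := tfamP u; have /asboolP[v0 _] := tfamP v.
by rewrite u0 // v0.
Qed.

Lemma tcoord_bij p c : chart_at c p -> bijective (@tcoord R n M p c).
Proof.
move=> cp; pose inv w := Tangent (tangent_extP w cp).
have invK : cancel inv (@tcoord R n M p c).
  by move=> w; rewrite /tcoord /= /tangent_ext asboolT// transition_id.
by exists inv => // v; apply: (tcoord_inj cp); rewrite invK.
Qed.

Definition tangent_vect_iso p : Vector.axiom n (tangent p) :=
  exist2 _ _ (@tcoord R n M p (some_chart p))
    (@tcoord_linear p (some_chart p)) (tcoord_bij (some_chartP p)).

HB.instance Definition _ p :=
  Lmodule_hasFinDim.Build R (tangent p) (tangent_vect_iso p).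

End TangentVect.

(* Not [{p : M & tangent p}], which carries the disjoint union topology. *)
Record tangent_bundle (R : realType) n (M : manifold R n) := TangentVector {
  tbase : M;
  tvec : tangent tbase }.

Definition triv (R : realType) n (M : manifold R n) (c : mchart M)
    (z : tangent_bundle M) : 'rV[R]_n * 'rV[R]_n :=
  (cmap c (tbase z), tcoord c (tvec z)).

Definition tangent_open (R : realType) n (M : manifold R n)
    (A : set (tangent_bundle M)) :=
  forall c : mchart M, atlas c ->
    open (triv c @` (A `&` [set z | cdom c (tbase z)])).

Section TangentBundleTopology.
Variables (R : realType) (n : nat) (M : manifold R n).
Local Notation TM := (tangent_bundle M).

HB.instance Definition _ := gen_eqMixin TM.
HB.instance Definition _ := gen_choiceMixin TM.

Lemma triv_inj (c : mchart M) (y z : TM) : atlas c ->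
  cdom c (tbase y) -> cdom c (tbase z) -> triv c y = triv c z -> y = z.
Proof.
move: y z => [p u] [q v] /= ca cp cq [pq].
have {}pq : p = q by rewrite -[p](@cmapK _ _ _ c) ?inE// pq cmapK ?inE.
by case: _ / pq in v cq * => /(tcoord_inj (conj ca cp)) ->.
Qed.

Fact tangent_openT : tangent_open [set: TM].
Proof.
move=> c ca; rewrite setTI (_ : _ @` _ = fst @^-1` (cmap c @` cdom c)).
  by apply: open_comp => [? _|]; [exact: cvg_fst|exact: cimg_open].
apply/seteqP; split=> [_ [z cz <-]|[x w] [p cp /= <-]].
  by exists (tbase z).
have [f _ fK] := tcoord_bij (conj ca cp).
by exists (TangentVector (f w)); rewrite /triv//= fK.
Qed.

Fact tangent_openI : setI_closed (@tangent_open R n M).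
Proof.
move=> A B oA oB c ca.
rewrite (_ : _ @` _ = (triv c @` (A `&` [set z | cdom c (tbase z)])) `&`
  (triv c @` (B `&` [set z | cdom c (tbase z)]))).
  by apply: openI; [exact: oA|exact: oB].
apply/seteqP; split=> [_ [z [[Az Bz] cz] <-]|x [[y [Ay cy] <-] [z [Bz cz]]]].
  by split; exists z.
by move=> /(triv_inj ca cz cy) zy; exists y => //; rewrite zy in Bz.
Qed.

Fact tangent_open_bigcup (I : Type) (F : I -> set TM) :
  (forall i, tangent_open (F i)) -> tangent_open (\bigcup_i F i).
Proof.
move=> oF c ca; rewrite setI_bigcupl image_bigcup.
by apply: bigcup_open => i _; exact: oF.
Qed.

HB.instance Definition _ := isOpenTopological.Build TM
  tangent_openT tangent_openI tangent_open_bigcup.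

End TangentBundleTopology.

Record metric (R : realType) n (M : manifold R n) := Metric {
  mform : forall p : M, tangent p -> tangent p -> R;
  mform_linear : forall p (v : tangent p), scalar (fun u : tangent p => mform u v);
  mform_sym : forall p (u v : tangent p), mform u v = mform v u;
  mform_nondegenerate : forall p (u : tangent p),
    (forall v, mform u v = 0) -> u = 0;
  (* [G] is the matrix of components of the metric in the chart [c]. *)
  mform_smooth : forall c : mchart M, atlas c ->
    exists2 G : 'rV[R]_n -> 'M[R]_n, smooth_on (cmap c @` cdom c) G &
      forall p, cdom c p -> forall u v : tangent p,
        mform u v = (tcoord c u *m G (cmap c p) *m (tcoord c v)^T) 0 0 }.

Definition negative_definite (R : realType) n (M : manifold R n)
    (g : metric M) (p : M) (W : {vspace tangent p}) :=
  forall v, v \in W -> v != 0 -> mform g v v < 0.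

Definition has_index (R : realType) n (M : manifold R n)
    (g : metric M) (p : M) (nu : nat) :=
  (exists2 W : {vspace tangent p}, negative_definite g W & \dim W = nu) /\
  (forall W : {vspace tangent p}, negative_definite g W -> (\dim W <= nu)%N).

Definition conformal (R : realType) n (M : manifold R n) (g h : metric M) :=
  exists Omega : M -> R, [/\ smooth_fun Omega, forall p, 0 < Omega p &
    forall p (u v : tangent p), mform h u v = Omega p * mform g u v].

Definition vector_field (R : realType) n (M : manifold R n) :=
  forall p : M, tangent p.

HB.instance Definition _ (R : realType) n (M : manifold R n) :=
  Choice.copy (vector_field M) (forall p : M, tangent p).

Definition continuous_field (R : realType) n (M : manifold R n)
    (Y : vector_field M) :=
  continuous (fun p => TangentVector (Y p) : tangent_bundle M).

Definition field_span (R : realType) n (M : manifold R n)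
    (X : {fset vector_field M}) (p : M) : {vspace tangent p} :=
  <<[seq Y p | Y : vector_field M <- enum_fset X]>>%VS.

Record spacetime (R : realType) n (M : manifold R n) (nu : nat) := Spacetime {
  smetric : metric M;
  smetric_index : forall p, has_index smetric p nu;
  sfields : {fset vector_field M};
  sfields_card : #|` sfields| = nu;
  sfields_continuous : forall Y, Y \in sfields -> continuous_field Y;
  sfields_dim : forall p, \dim (field_span sfields p) = nu;
  sfields_negative : forall p,
    negative_definite smetric (field_span sfields p) }.

Definition convex_cone (R : realType) (V : lmodType R) (C : set V) :=
  [/\ ~ C 0, convex_set (C : set (convex_lmodType V)) &
      forall v s, C v -> 0 < s -> C (s *: v)].

Definition sharp_cone (R : realType) (V : lmodType R) (C : set V) :=
  forall v, v != 0 -> ~ (forall t : R, (C `|` [set 0]) (t *: v)).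

(* Closed in V \ {0} for the topology of V given by a linear isomorphism
   [v2r] with R^m. *)
Definition closed_cone (R : realType) (V : vectType R) (C : set V) :=
  exists2 F : set 'rV[R]_(dim V), closed F &
    C = (VectorInternalTheory.v2r @^-1` F) `\ 0.

Definition cone_map (R : realType) n (M : manifold R n) :=
  forall p : M, set (tangent p).

Section ConeStructures.
Variables (R : realType) (n : nat) (M : manifold R n).
Implicit Type C : cone_map M.

Definition cone_structure C := forall p,
  [/\ C p !=set0, closed_cone (C p), sharp_cone (C p) & convex_cone (C p)].

Definition cone_total C : set (tangent_bundle M) :=
  [set z | C (tbase z) (tvec z)].

Definition slit_bundle : set (tangent_bundle M) := [set z | tvec z != 0].

Definition closed_cone_structure C :=
  cone_structure C /\
  exists2 F, closed F & cone_total C = F `&` slit_bundle.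

Definition proper_cone_structure C :=
  closed_cone_structure C /\
  forall p, exists v : tangent p, (cone_total C)° (TangentVector v).

(* The library norm on ['rV[R]_n] is the sup norm. *)
Definition euclidean_ball : set 'rV[R]_n :=
  [set x | \sum_i x 0 i ^+ 2 <= 1].

Definition local_cone C (c : mchart M) (p : M) : set 'rV[R]_n :=
  (tcoord c @` (C p `|` [set 0])) `&` euclidean_ball.

Definition upper_semicontinuous_in (c : mchart M) (F : M -> set 'rV[R]_n) :=
  forall p0, cdom c p0 -> forall V, set_nbhs (F p0) V ->
    \forall p \near p0, F p `<=` V.

Definition lower_semicontinuous_in (c : mchart M) (F : M -> set 'rV[R]_n) :=
  forall (p0 : M) (p : nat -> M),
    cdom c p0 -> (forall k, cdom c (p k)) -> p @ \oo --> p0 ->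
  forall y0, F p0 y0 ->
    exists2 y : nat -> 'rV[R]_n, forall k, F (p k) (y k) & y @ \oo --> y0.

Definition continuous_cone_structure C :=
  forall c, atlas c -> upper_semicontinuous_in c (local_cone C c) /\
                       lower_semicontinuous_in c (local_cone C c).

End ConeStructures.

(* The cone structure may depend on the vector fields, but it depends on the
   metric only through its conformal class. *)
Definition conformally_invariant (R : realType) n (M : manifold R n) (nu : nat)
    (C : spacetime M nu -> cone_map M) :=
  forall S T : spacetime M nu, sfields S = sfields T ->
    conformal (smetric S) (smetric T) -> C S = C T.

(* Main.v *)
(* Let X_1, ..., X_nu be the given fields, P the g-orthogonal projection onto their
   span and h(u, v) = g(u, v) - 2 g(P u, P v), which is positive definite because
   nu is the index of g. The cone at p is the set of nonzero v with f v >= 0, where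
     f v = - 2 g(v, X_1) - sqrt (- g(X_1, X_1) h(v, v)).
   Since sqrt (h(v, v)) is a norm, f is superadditive, positively homogeneous and
   continuous on TM, with f(X_1) > 0 and f v + f(- v) < 0; these properties alone
   give a continuous proper cone structure. A conformal factor of g leaves P
   unchanged and multiplies f by a positive function. *)

Require Import Defs.
From HB Require Import structures.
From mathcomp Require Import all_boot all_order all_algebra finmap.
From mathcomp Require Import all_classical all_reals all_analysis.
From mathcomp Require Import ring lra.
Set Implicit Arguments.
Unset Strict Implicit.
Unset Printing Implicit Defensive.
Import Order.TTheory GRing.Theory Num.Theory.
Import numFieldNormedType.Exports.
Local Open Scope classical_set_scope.
Local Open Scope ring_scope.

(** * Linear algebra in one tangent space: projection, flipped form and cone function *)

Section GramProjection.
Variables (R : realType) (V : vectType R) (g : V -> V -> R).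
Variables (m : nat) (x : m.-tuple V).

Definition gram : 'M[R]_m := \matrix_(i, j) g x`_i x`_j.

(** The coefficients solve the linear system making [v - gram_proj v] orthogonal to every [x_k].
    When the Gram matrix is invertible this is the g-orthogonal projection onto the span, in a form
    whose continuous dependence on the base point can be read off. *)
Definition gram_proj v : V :=
  \sum_i ((\row_k g v x`_k) *m invmx gram) 0 i *: x`_i.

(* [g] with its sign changed on the span of [x]. *)
Definition flip_form u v := g u v - 2 * g (gram_proj u) (gram_proj v).

(** Write h for [flip_form]. In the spacetime setting h is an inner product with h(v, x_0) = - g(v,
    x_0), so this is 2 h(v, x_0) - |x_0| |v| in h-norms: it is nonnegative on the nonzero vectors at
    h-angle at most pi/3 from x_0. *)
Definition cone_fun v :=
  - 2 * g v x`_0 - Num.sqrt (- g x`_0 x`_0 * flip_form v v).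

Hypothesis gl : forall v, scalar (g^~ v).
Hypothesis gC : forall u v, g u v = g v u.

Let gZD a u v w : g (a *: u + v) w = a * g u w + g v w.
Proof. exact: gl. Qed.
Let gD u v w : g (u + v) w = g u w + g v w.
Proof. by have := gZD 1 u v w; rewrite scale1r mul1r. Qed.
Let g0 w : g 0 w = 0.
Proof. by have := gD 0 0 w; rewrite addr0 => /eqP; rewrite -subr_eq subrr eq_sym => /eqP. Qed.
Let gZ a u w : g (a *: u) w = a * g u w.
Proof. by have := gZD a u 0 w; rewrite addr0 g0 addr0. Qed.
Let gN u w : g (- u) w = - g u w.
Proof. by rewrite -scaleN1r gZ mulN1r. Qed.
Let gDr u v w : g w (u + v) = g w u + g w v.
Proof. by rewrite gC gD gC [g v w]gC. Qed.
Let gZr a u w : g w (a *: u) = a * g w u.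
Proof. by rewrite gC gZ gC. Qed.
Let g_suml (I : finType) (F : I -> V) w : g (\sum_i F i) w = \sum_i g (F i) w.
Proof. by exact: (big_morph (g^~ w) (fun u v => gD u v w) (g0 w)). Qed.
Let g_sumr (I : finType) (F : I -> V) w : g w (\sum_i F i) = \sum_i g w (F i).
Proof. by rewrite gC g_suml; apply: eq_bigr => i _; rewrite gC. Qed.

Lemma gram_proj_linear : linear gram_proj.
Proof.
move=> a u v; rewrite /gram_proj scaler_sumr -big_split; apply: eq_bigr => i _ /=.
rewrite scalerA -scalerDl; congr (_ *: _).
have -> : \row_(k < m) g (a *: u + v) x`_k =
    a *: (\row_(k < m) g u x`_k) + \row_(k < m) g v x`_k.
  by apply/rowP => k; rewrite !mxE gZD.
by rewrite mulmxDl -scalemxAl !mxE.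
Qed.

Lemma gram_proj_span v : gram_proj v \in <<x>>%VS.
Proof.
by apply: memv_suml => i _; apply: memvZ; apply: memv_span; rewrite mem_nth ?size_tuple.
Qed.

Hypothesis x_free : free x.
Hypothesis x_neg : forall v, v \in <<x>>%VS -> v != 0 -> g v v < 0.

(** A kernel vector gives a combination [w] of the [x_i] orthogonal to all of them, hence to itself.
    Negative definiteness forces [w = 0], and freeness then kills the coefficients. *)
Lemma gram_unit : gram \in unitmx.
Proof.
rewrite -row_free_unit -kermx_eq0; apply/rowV0P => u /sub_kermxP uA.
pose w := \sum_i u 0 i *: x`_i.
have wx k : (k < m)%N -> g w x`_k = 0.
  move=> kx; have /rowP/(_ (Ordinal kx)) := uA; rewrite !mxE => <-.
  by rewrite g_suml; apply: eq_bigr => i _; rewrite gZ mxE.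
have wW : w \in <<x>>%VS.
  by apply: memv_suml => i _; apply: memvZ; apply: memv_span; rewrite mem_nth ?size_tuple.
have gw : g w w = 0.
  by rewrite {2}/w g_sumr big1// => i _; rewrite gZr wx ?mulr0.
have w0 : w = 0.
  by apply/eqP; case: (eqVneq w 0) => // /(x_neg wW); rewrite gw ltxx.
by apply/rowP => i; rewrite mxE; apply: (@freeP _ _ _ x x_free (u 0)).
Qed.

Lemma gram_projP v w : w \in <<x>>%VS -> g (gram_proj v) w = g v w.
Proof.
move=> /(@coord_span _ _ _ x) ->; rewrite !g_sumr; apply: eq_bigr => k _; rewrite !gZr.
congr (_ * _); rewrite /= g_suml.
transitivity ((\row_(k < m) g v x`_k *m invmx gram *m gram) 0 k).
  by rewrite mxE; apply: eq_bigr => i _; rewrite gZ [gram _ _]mxE.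
by rewrite mulmxKV ?gram_unit// mxE.
Qed.

(** Only the numbers g(v, x_i) and the inverse Gram matrix remain on the right; the continuity of
    the cone function rests on this expression. *)
Lemma gram_proj_norm v : g (gram_proj v) (gram_proj v) =
  \sum_(i < m) (\sum_(j < m) g v x`_j * invmx gram j i) * g v x`_i.
Proof.
rewrite gram_projP ?gram_proj_span// {1}/gram_proj g_sumr.
apply: eq_bigr => i _; rewrite gZr mxE; congr (_ * _).
by apply: eq_bigr => j _; rewrite mxE.
Qed.

Hypothesis x_max : forall W : {vspace V},
  (forall v, v \in W -> v != 0 -> g v v < 0) -> (\dim W <= m)%N.
Hypothesis g_nondeg : forall u, (forall v, g u v = 0) -> u = 0.

(* A negative vector orthogonal to the span would enlarge it. *)
Lemma orth_ge0 u : (forall w, w \in <<x>>%VS -> g u w = 0) -> 0 <= g u u.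
Proof.
move=> uW; rewrite leNgt; apply/negP => u_neg.
have uNW : u \notin <<x>>%VS by apply/negP => /uW gu; rewrite gu ltxx in u_neg.
have : (\dim (<<x>> + <[u]>)%VS <= m)%N.
  apply: x_max => _ /memv_addP[w wW [_ /vlineP[a ->] ->]] nz.
  rewrite !(gD, gDr, gZ, gZr) uW// [g w u]gC uW// !mulr0 addr0 add0r mulrA.
  have [a0|a0] := eqVneq a 0.
    by move: nz; rewrite a0 scale0r addr0 mulr0 mul0r addr0; exact: x_neg.
  have w_le0 : g w w <= 0.
    by have [->|w0] := eqVneq w 0; rewrite ?g0// ltW// x_neg.
  have a2 : 0 < a * a by rewrite -expr2 exprn_even_gt0.
  by rewrite -[ltRHS]addr0 ler_ltD// pmulr_rlt0.
rewrite dimv_disjoint_sum; last first.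
  apply/eqP; rewrite -subv0; apply/subvP => w /memv_capP[wW /vlineP[a wE]].
  rewrite memv0; apply/negP => /negP w0; have a0 : a != 0.
    by apply: contra w0 => /eqP a0; rewrite wE a0 scale0r.
  by case/negP: uNW; rewrite -[u](scalerK a0) -wE memvZ.
rewrite dim_vline (_ : u != 0); last by apply: contra uNW => /eqP ->; exact: mem0v.
by rewrite (eqnP x_free) size_tuple addn1 ltnn.
Qed.

Lemma gram_proj_orth u w : w \in <<x>>%VS -> g (u - gram_proj u) w = 0.
Proof. by move=> wW; rewrite gD gN gram_projP// subrr. Qed.

Lemma gram_proj_id w : w \in <<x>>%VS -> gram_proj w = w.
Proof.
move=> wW; apply/eqP; rewrite eq_sym -subr_eq0; apply/eqP.
have dW : w - gram_proj w \in <<x>>%VS by rewrite rpredB// gram_proj_span.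
by apply: contra_eq (gram_proj_orth w dW) => /(x_neg dW) /lt_eqF ->.
Qed.

(** By [orth_ge0], g is semidefinite on the orthogonal complement of the span. A null vector there
    is orthogonal to the complement, as for any semidefinite form, and to the span, so nondegeneracy
    makes it zero. *)
Lemma orth_gt0 u : (forall w, w \in <<x>>%VS -> g u w = 0) -> u != 0 ->
  0 < g u u.
Proof.
move=> uW; rewrite lt_neqAle orth_ge0// andbT; apply: contra_neq => /esym guu.
apply: g_nondeg => v; rewrite -(subrK (gram_proj v) v).
move: (v - _) (gram_proj_orth v) => w wW.
rewrite gDr (uW (gram_proj v)) ?gram_proj_span// addr0.
apply/eqP/negP => /negP guw.
(* This [t] solves 2 t g(u, w) + g(w, w) = -1, so the vector [t *: u + w] of the complement would
   have square -1. *)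
pose t := - (g w w + 1) / (2 * g u w).
have : 0 <= g (t *: u + w) (t *: u + w).
  apply: orth_ge0 => z zW.
  by rewrite gD gZ uW// wW// mulr0 addr0.
rewrite !(gD, gDr, gZ, gZr) guu !mulr0 add0r [g w u]gC addrA -mulr2n.
have -> : (t * g u w) *+ 2 = - (g w w + 1).
  by rewrite -mulr_natl mulrCA divfK// mulf_neq0// pnatr_eq0.
by rewrite opprD addrAC addNr add0r oppr_ge0 ler10.
Qed.

Lemma flip_formDZ a u v w :
  flip_form (a *: u + v) w = a * flip_form u w + flip_form v w.
Proof. by rewrite /flip_form gram_proj_linear !gZD; ring. Qed.

Lemma flip_formC u v : flip_form u v = flip_form v u.
Proof. by rewrite /flip_form gC [g (gram_proj u) _]gC. Qed.

Lemma flip_formDZr a u v w :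
  flip_form w (a *: u + v) = a * flip_form w u + flip_form w v.
Proof. by rewrite flip_formC flip_formDZ ![flip_form _ w]flip_formC. Qed.

Lemma flip_form0 u : flip_form u 0 = 0.
Proof.
have := flip_formDZr 1 0 0 u; rewrite scaler0 addr0 mul1r => /esym/eqP.
by rewrite -subr_eq0 addrK => /eqP.
Qed.

(** Split u = w + p with p in the span and w orthogonal to it. The cross terms vanish and the value
    is g(w, w) - g(p, p), where both contributions are nonnegative and one is positive. *)
Lemma flip_form_gt0 u : u != 0 -> 0 < flip_form u u.
Proof.
move=> u0; pose p := gram_proj u; have pW : p \in <<x>>%VS by exact: gram_proj_span.
have [w uE wW] : exists2 w, u = w + p & forall z, z \in <<x>>%VS -> g w z = 0.
  by exists (u - p); [rewrite subrK|exact: gram_proj_orth].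
have -> : flip_form u u = g w w - g p p.
  have guu : g u u = g w w + g p p.
    by rewrite uE gD !gDr [g p w]gC (wW p pW) addr0 add0r.
  by rewrite /flip_form guu -/p; ring.
have [p0|p0] := eqVneq p 0.
  rewrite p0 g0 subr0; apply: orth_gt0 => //.
  by rewrite uE p0 addr0 in u0.
by rewrite ltr_wpDl ?oppr_gt0 ?x_neg// orth_ge0.
Qed.

Lemma flip_form_ge0 u : 0 <= flip_form u u.
Proof.
by have [->|/flip_form_gt0/ltW//] := eqVneq u 0; rewrite flip_form0.
Qed.

Lemma flip_form_CauchySchwarz u v :
  flip_form u v ^+ 2 <= flip_form u u * flip_form v v.
Proof.
have [->|v0] := eqVneq v 0; first by rewrite !flip_form0 expr0n mulr0.
(* With a = h(u, u), b = h(v, v), c = h(u, v), the square of b u - c v is b (a b - c^2). The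
   trailing [0] gives both summands the shape that [flip_formDZ] rewrites. *)
have := flip_form_ge0 (flip_form v v *: u + (- flip_form u v *: v + 0)).
rewrite !(flip_formDZ, flip_formDZr) !flip_form0 [flip_form 0 _]flip_formC.
rewrite [flip_form v u]flip_formC [flip_form 0 _]flip_formC !flip_form0.
set a := flip_form u u; set b := flip_form v v; set c := flip_form u v => H.
rewrite -subr_ge0 -(pmulr_rge0 _ (flip_form_gt0 v0)) -/b.
by apply: le_trans H _; rewrite le_eqVlt; apply/orP; left; apply/eqP; ring.
Qed.

Hypothesis x_gt0 : (0 < m)%N.

Let x0_span : x`_0 \in <<x>>%VS.
Proof. by apply: memv_span; rewrite mem_nth ?size_tuple. Qed.

Let x0_neg : 0 < - g x`_0 x`_0.
Proof.
by rewrite oppr_gt0 x_neg// (free_not0 x_free) ?mem_nth ?size_tuple.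
Qed.

Let nrm v := Num.sqrt (- g x`_0 x`_0 * flip_form v v).

(** After squaring, this is the Cauchy-Schwarz inequality multiplied by the constant - g(x_0,
    x_0). *)
Let nrmD u v : nrm (u + v) <= nrm u + nrm v.
Proof.
have b0 := ltW x0_neg; rewrite /nrm; move: b0; set b := - g _ _ => b0.
have bh z : 0 <= b * flip_form z z by rewrite mulr_ge0// flip_form_ge0.
rewrite -[leRHS]ger0_norm ?addr_ge0 ?sqrtr_ge0// -sqrtr_sqr ler_wsqrtr//.
rewrite sqrrD !sqr_sqrtr//.
have -> : u + v = 1 *: u + v by rewrite scale1r.
rewrite !(flip_formDZ, flip_formDZr) [flip_form v u]flip_formC.
suff : b * flip_form u v <=
    Num.sqrt (b * flip_form u u) * Num.sqrt (b * flip_form v v) by lra.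
rewrite -sqrtrM//; apply: le_trans (ler_norm _) _.
rewrite -sqrtr_sqr ler_wsqrtr//.
have := flip_form_CauchySchwarz u v; nra.
Qed.

Lemma cone_funD u v : cone_fun u + cone_fun v <= cone_fun (u + v).
Proof. by rewrite /cone_fun gD; have := nrmD u v; rewrite /nrm; lra. Qed.

Lemma cone_funZ s v : 0 <= s -> cone_fun (s *: v) = s * cone_fun v.
Proof.
move=> s0; rewrite /cone_fun gZ.
have -> : flip_form (s *: v) (s *: v) = s ^+ 2 * flip_form v v.
  rewrite -[s *: v]addr0 !(flip_formDZ, flip_formDZr).
  by rewrite [flip_form 0 _]flip_formC !flip_form0; ring.
by rewrite [X in Num.sqrt X]mulrCA sqrtrM ?sqr_ge0// sqrtr_sqr ger0_norm//; ring.
Qed.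

(** The linear parts cancel and minus twice a norm is left. This makes the cone sharp and keeps its
    convex combinations away from zero. *)
Lemma cone_funDN v : v != 0 -> cone_fun v + cone_fun (- v) < 0.
Proof.
move=> v0; have -> : cone_fun v + cone_fun (- v) = - (nrm v *+ 2).
  rewrite /cone_fun gN (_ : flip_form (- v) (- v) = flip_form v v) /nrm.
    by ring.
  rewrite -scaleN1r -[_ *: v]addr0 !(flip_formDZ, flip_formDZr).
  by rewrite [flip_form 0 _]flip_formC !flip_form0; ring.
by rewrite oppr_lt0 pmulrn_lgt0// sqrtr_gt0 mulr_gt0// flip_form_gt0.
Qed.

(** Here the root equals - g(x_0, x_0), so the value is - g(x_0, x_0). The factor 2 in [cone_fun] is
    what leaves it positive: with 1 it would be 0. *)
Lemma cone_fun_head_gt0 : 0 < cone_fun x`_0.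
Proof.
rewrite /cone_fun (_ : flip_form _ _ = - g x`_0 x`_0).
  by rewrite -expr2 sqrtr_sqr gtr0_norm//; have := x0_neg; lra.
by rewrite /flip_form gram_proj_id//; ring.
Qed.

End GramProjection.

(** * Behaviour under a conformal factor *)

Lemma gram_projZ (R : realType) (V : vectType R) (g g' : V -> V -> R)
    (m : nat) (x : m.-tuple V) (a : R) :
  a != 0 -> gram g x \in unitmx -> (forall u v, g' u v = a * g u v) ->
  gram_proj g' x =1 gram_proj g x.
Proof.
move=> a0 gu g'E v; apply: eq_bigr => i _; congr (_ *: _).
have -> : gram g' x = a *: gram g x by apply/matrixP => j k; rewrite !mxE g'E.
have -> : \row_(k < m) g' v x`_k = a *: \row_(k < m) g v x`_k.
  by apply/rowP => k; rewrite !mxE g'E.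
rewrite invmxZ ?unitmxZ ?unitfE// -scalemxAl -scalemxAr scalerA.
by rewrite divff// scale1r.
Qed.

(** The factor g(x_0, x_0) under the root is there for this: the product scales by [a ^+ 2], so both
    terms of [cone_fun] have degree one in g. *)
Lemma cone_fun_scale (R : realType) (V : vectType R) (g g' : V -> V -> R)
    (m : nat) (x : m.-tuple V) (a : R) v :
  0 < a -> gram g x \in unitmx -> (forall u v, g' u v = a * g u v) ->
  cone_fun g' x v = a * cone_fun g x v.
Proof.
move=> a0 gu g'E.
have hE : - g' x`_0 x`_0 * flip_form g' x v v =
    a ^+ 2 * (- g x`_0 x`_0 * flip_form g x v v).
  by rewrite /flip_form !(gram_projZ (lt0r_neq0 a0) gu g'E) !g'E; ring.
rewrite /cone_fun hE sqrtrM ?sqr_ge0// sqrtr_sqr gtr0_norm// g'E; ring.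
Qed.

(** * Limits of matrix expressions and of differentials *)

Lemma cvg_congr (T : Type) (U : topologicalType) (F : set_system T) (f h : T -> U) (a b : U) :
  f =1 h -> a = b -> h @ F --> b -> f @ F --> a.
Proof. by move=> /funext -> ->. Qed.

Section CvgMatrix.
Variables (R : realType) (T : Type) (F : set_system T).
Context {FF : Filter F}.

Lemma cvg_sum (I : Type) (r : seq I) (P : pred I) (f : I -> T -> R) (a : I -> R) :
  (forall i, P i -> f i @ F --> a i) ->
  \sum_(i <- r | P i) f i t @[t --> F] --> \sum_(i <- r | P i) a i.
Proof. by move=> fa; apply: cvg_big => //; exact: add_continuous. Qed.

Lemma cvg_prod (I : Type) (r : seq I) (P : pred I) (f : I -> T -> R) (a : I -> R) :
  (forall i, P i -> f i @ F --> a i) ->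
  \prod_(i <- r | P i) f i t @[t --> F] --> \prod_(i <- r | P i) a i.
Proof. by move=> fa; apply: cvg_big => //; exact: mul_continuous. Qed.

Lemma cvg_det m (A : T -> 'M[R]_m) (A0 : 'M[R]_m) :
  (forall i j, A t i j @[t --> F] --> A0 i j) -> \det (A t) @[t --> F] --> \det A0.
Proof.
move=> cA; apply: cvg_sum => s _; apply: cvgM; first exact: cvg_cst.
by apply: cvg_prod => i _; exact: cA.
Qed.

(** By Cramer's rule each entry is a cofactor over the determinant, both polynomial in the entries
    of the matrix. *)
Lemma cvg_invmx m (A : T -> 'M[R]_m) (A0 : 'M[R]_m) :
  (forall t, A t \in unitmx) -> A0 \in unitmx ->
  (forall i j, A t i j @[t --> F] --> A0 i j) ->
  forall i j, invmx (A t) i j @[t --> F] --> invmx A0 i j.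
Proof.
move=> uA uA0 cA i j.
rewrite (_ : (fun t => _) = fun t => (\det (A t))^-1 * cofactor (A t) j i); last first.
  by apply/funext => t; rewrite /invmx uA !mxE.
rewrite /invmx uA0 !mxE; apply: cvgM.
  by apply: cvgV; [rewrite -unitfE -unitmxE|exact: cvg_det].
rewrite /cofactor; apply: cvgM; first exact: cvg_cst.
apply: cvg_det => k l; rewrite !mxE.
by rewrite (_ : (fun t => _) = fun t => A t (lift j k) (lift i l))//;
  apply/funext => t; rewrite !mxE.
Qed.

Lemma cvg_coord m n (A : T -> 'M[R]_(m, n)) (A0 : 'M[R]_(m, n)) i j :
  A @ F --> A0 -> A t i j @[t --> F] --> A0 i j.
Proof. by move=> cA; apply: (cvg_comp A (fun B => B i j) cA); exact: coord_continuous. Qed.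

Lemma cvg_sqr_sum n (w : T -> 'rV[R]_n) (w0 : 'rV[R]_n) : w @ F --> w0 ->
  \sum_i w t 0 i ^+ 2 @[t --> F] --> \sum_i w0 0 i ^+ 2.
Proof.
move=> cw; apply: cvg_sum => i _.
apply: (cvg_comp (fun t => w t 0 i) (fun r : R => r ^+ 2) (cvg_coord cw)).
exact: exprn_continuous.
Qed.

Lemma cvg_linear k (W : normedModType R) (L : 'rV[R]_k -> W)
    (w : T -> 'rV[R]_k) (w0 : 'rV[R]_k) :
  linear L -> w @ F --> w0 -> L (w t) @[t --> F] --> L w0.
Proof.
move=> Ll cw.
have LE y : L y = \sum_i y 0 i *: L (delta_mx 0 i).
  pose L' : {linear 'rV[R]_k -> W} :=
    HB.pack L (GRing.isLinear.Build R 'rV[R]_k W _ L Ll).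
  rewrite -[L]/(L' : _ -> _) {1}[y]row_sum_delta linear_sum.
  by apply: eq_bigr => i _; rewrite linearZ.
apply: (cvg_congr (fun t => LE (w t)) (LE w0)).
apply: cvg_big => //; first exact: add_continuous.
by move=> i _; apply: cvgZ; [exact: cvg_coord|exact: cvg_cst].
Qed.

(** Smoothness speaks of differentials at fixed vectors. Expanding [w] in the standard basis reduces
    joint continuity to those, and class C^2 makes each of them differentiable, hence continuous. *)
Lemma cvg_diff n (W : normedModType R) (U : set 'rV[R]_n) (f : 'rV[R]_n -> W)
    (x w : T -> 'rV[R]_n) (x0 w0 : 'rV[R]_n) :
  smooth_on U f -> U x0 -> x @ F --> x0 -> w @ F --> w0 ->
  'd f (x t) (w t) @[t --> F] --> 'd f x0 w0.
Proof.
move=> fU Ux0 cx cw.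
have dE y v : 'd f y v = \sum_i v 0 i *: 'd f y (delta_mx 0 i).
  by rewrite {1}[v]row_sum_delta linear_sum; apply: eq_bigr => i _; rewrite linearZ.
apply: (cvg_congr (fun t => dE (x t) (w t)) (dE x0 w0)).
apply: cvg_big => //; first exact: add_continuous.
move=> i _; apply: cvgZ; first exact: cvg_coord.
apply: (cvg_comp x (fun y => 'd f y (delta_mx 0 i)) cx).
have [_ /(_ (delta_mx 0 i))[+ _]] := fU 2%N.
by move=> /(_ x0 Ux0) /differentiable_continuous.
Qed.

End CvgMatrix.

(** * Product filters and local trivialisations of the tangent bundle *)

Lemma near_fst (T U : topologicalType) (a : T) (b : U) (P : T -> Prop) :
  (\forall x \near a, P x) -> \forall y \near (a, b), P y.1.
Proof. exact: cvg_fst. Qed.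

Lemma near_snd (T U : topologicalType) (a : T) (b : U) (P : U -> Prop) :
  (\forall x \near b, P x) -> \forall y \near (a, b), P y.2.
Proof. exact: cvg_snd. Qed.

Lemma cvg_comp_fst (T U W : topologicalType) (h : T -> W) (a : T) (b : U) (l : W) :
  h @ a --> l -> h y.1 @[y --> (a, b)] --> l.
Proof. by move=> hl N Nl; exact: (@near_fst _ _ a b (h @^-1` N) (hl N Nl)). Qed.

Section TangentCharts.
Variables (R : realType) (n : nat) (M : manifold R n).
Implicit Types (p : M) (c d : mchart M).

(* Inverse of [tcoord c], with value [0] when [c] is not a chart around [p]. *)
Definition chart_vect c p (w : 'rV[R]_n) : tangent p :=
  if pselect (chart_at c p) is left cp then Tangent (tangent_extP w cp) else 0.

Lemma chart_vectK c p : chart_at c p -> cancel (chart_vect c p) (tcoord c).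
Proof.
move=> cp w; rewrite /chart_vect; case: pselect => // cp'.
by rewrite /tcoord /= /tangent_ext asboolT// transition_id.
Qed.

Lemma tcoordK c p : chart_at c p -> cancel (tcoord c) (chart_vect c p).
Proof. by move=> cp v; apply: (tcoord_inj cp); rewrite chart_vectK. Qed.

Lemma near_chart_at c p : chart_at c p -> \forall q \near p, chart_at c q.
Proof.
move=> [ca cp]; have : nbhs p (cdom c).
  by apply: open_nbhs_nbhs; split => //; exact: cdom_open.
by apply: filterS => q cq; split.
Qed.

Lemma cmap_cvg c p : chart_at c p -> cmap c q @[q --> p] --> cmap c p.
Proof.
move=> [ca cp]; have := @cmap_continuous _ _ _ c.
rewrite continuous_open_subspace; last exact: cdom_open.
by apply; rewrite inE.
Qed.

Lemma cinv_cvg c p : chart_at c p -> cinv c x @[x --> cmap c p] --> p.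
Proof.
move=> [ca cp]; have := @cinv_continuous _ _ _ c.
rewrite continuous_open_subspace; last exact: cimg_open.
move=> /(_ (cmap c p)); rewrite /continuous_at cmapK ?inE//; apply.
by exists p.
Qed.

(** Openness is defined through images under [triv]. Continuity of [cinv] carries neighbourhoods of
    the base point into the chart, so it suffices to vary a point of [M] and a component vector
    separately. *)
Lemma open_tangent_bundle (A : set (tangent_bundle M)) :
  (forall c z, chart_at c (tbase z) -> A z ->
    \forall q \near tbase z & w \near tcoord c (tvec z),
      A (TangentVector (chart_vect c q w))) ->
  open A.
Proof.
move=> nA; rewrite -[open A]/(tangent_open A) => c ca; rewrite openE => _ [z [Az cz] <-].
have [[N1 N2] /= [n1 n2] sN] := nA c z (conj ca cz) Az.
have nc1 : nbhs (cmap c (tbase z)) (cinv c @^-1` N1) := cinv_cvg (conj ca cz) n1.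
rewrite /interior /triv /=.
near=> y; have [q cq qy] : (cmap c @` cdom c) y.1.
  near: y; apply: (@near_fst _ _ _ _ (cmap c @` cdom c)).
  by apply: open_nbhs_nbhs; split; [exact: cimg_open|exists (tbase z)].
exists (TangentVector (chart_vect c q y.2)); last first.
  by rewrite /triv /= chart_vectK// qy -surjective_pairing.
split => //; apply: (sN (q, y.2)); split => /=.
  rewrite -[q](@cmapK _ _ _ c) ?inE// qy; near: y.
  exact: near_fst nc1.
by near: y; exact: near_snd n2.
Unshelve. all: by end_near. Qed.

(** The preimage of an open box is open: seen from another chart [d], the components in [c] arise by
    the differential of the transition map, which is jointly continuous by [cvg_diff]. *)
Lemma triv_cvg c (z : tangent_bundle M) :
  chart_at c (tbase z) -> triv c y @[y --> z] --> triv c z.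
Proof.
move=> cz O [[N1 N2] /= [n1 n2] sN].
have ca := cz.1.
pose A := [set y : tangent_bundle M | chart_at c (tbase y) /\ (N1° `*` N2°) (triv c y)].
have Az : A z by split.
suff oA : open A.
  apply: filterS (open_nbhs_nbhs (conj oA Az)) => y [_ [y1 y2]]; apply: sN.
  by split; exact: interior_subset.
apply: open_tangent_bundle => d [p v] /= dp [cp [/= Np Nv]].
have dcd : (tcoord c (chart_vect d y.1 y.2)) @[y --> (p, tcoord d v)] --> tcoord c v.
  rewrite (tcoord_transition v dp cp).
  apply: cvg_trans; last first.
    apply: (@cvg_diff _ _ (nbhs (p, tcoord d v)) _ _ _ _ _
      (fun y : M * _ => cmap d y.1) snd _ _ (atlas_smooth dp.1 cp.1)).
    - by exists p; [split; [exact: dp.2|exact: cp.2]|].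
    - exact/cvg_comp_fst/cmap_cvg.
    - exact: cvg_snd.
  apply: near_eq_cvg; near=> y.
  have dy : chart_at d y.1 by near: y; apply: near_fst; exact: near_chart_at.
  have cy : chart_at c y.1 by near: y; apply: near_fst; exact: near_chart_at.
  by rewrite (tcoord_transition _ dy cy) chart_vectK.
have cdc : cmap c y.1 @[y --> (p, tcoord d v)] --> cmap c p.
  exact/cvg_comp_fst/cmap_cvg.
near=> y; split.
  by near: y; apply: near_fst; exact: near_chart_at.
split; rewrite /triv /=; near: y.
  by apply: cdc; exact: nbhs_interior.
by apply: dcd; exact: nbhs_interior.
Unshelve. all: by end_near. Qed.

Lemma field_cvg c p (Y : vector_field M) : continuous_field Y ->
  chart_at c p -> tcoord c (Y q) @[q --> p] --> tcoord c (Y p).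
Proof.
move=> cY cp; have := cvg_comp _ (triv c) (cY p) (triv_cvg (z := TangentVector (Y p)) cp).
by move=> /(cvg_comp _ snd)/(_ cvg_snd).
Qed.

(** Continuity on the tangent bundle, tested on pairs of a base point in [M] and components in a
    chart. The default value of [chart_vect] is harmless, since base points near [p] lie in the
    chart. *)
Definition fibre_continuous (f : forall p, tangent p -> R) :=
  forall c p (w : 'rV[R]_n), chart_at c p ->
    f _ (chart_vect c y.1 y.2) @[y --> (p, w)] --> f p (chart_vect c p w).

Lemma fibre_cvg (f : forall p, tangent p -> R) (T : Type) (F : set_system T)
    (FF : Filter F) c (p : T -> M) p0 (w : T -> 'rV[R]_n) (w0 : 'rV[R]_n) :
  fibre_continuous f -> chart_at c p0 -> p @ F --> p0 -> w @ F --> w0 ->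
  f _ (chart_vect c (p t) (w t)) @[t --> F] --> f p0 (chart_vect c p0 w0).
Proof.
move=> fc cp pp ww.
have pw : (p t, w t) @[t --> F] --> (p0, w0) by refine (cvg_pair pp ww).
exact: (cvg_comp (fun t => (p t, w t))
  (fun y : M * 'rV[R]_n => f _ (chart_vect c y.1 y.2)) pw (fc c p0 w0 cp)).
Qed.

End TangentCharts.

(** * Cone structures defined by a superadditive function on the fibres *)

Lemma euclidean_ball_compact (R : realType) n : compact (@euclidean_ball R n).
Proof.
apply: bounded_closed_compact.
  exists 1; split => // r r1 x /= xb.
  have r0 : 0 <= r by rewrite ltW// (lt_trans ltr01).
  rewrite /Num.norm/= mx_normrE; apply/bigmax_leP; split=> // -[i j] _ /=.
  rewrite ord1; apply: le_trans (ltW r1).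
  rewrite -(@ler_pXn2r _ 2) ?nnegrE// expr1n real_normK ?num_real//.
  apply: le_trans xb; rewrite (bigD1 j)//= lerDl.
  by apply: sumr_ge0 => k _; exact: sqr_ge0.
apply: (@closed_comp _ _ (fun x : 'rV[R]_n => \sum_i x 0 i ^+ 2)
  [set r : R | r <= 1]); last exact: closed_le.
by move=> x _; exact: (@cvg_sqr_sum _ _ (nbhs x) _ _ id x (@cvg_id _ _)).
Qed.

Section FunctionCone.
Variables (R : realType) (n : nat) (M : manifold R n).
Variables (f : forall p : M, tangent p -> R) (Z : vector_field M).
Hypothesis fD : forall p (u v : tangent p), f u + f v <= f (u + v).
Hypothesis fZ : forall p s (v : tangent p), 0 <= s -> f (s *: v) = s * f v.
Hypothesis fDN : forall p (v : tangent p), v != 0 -> f v + f (- v) < 0.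
Hypothesis fZ_gt0 : forall p, 0 < f (Z p).
Hypothesis f_cont : fibre_continuous f.
Hypothesis Z_cont : forall c p, chart_at c p ->
  tcoord c (Z q) @[q --> p] --> tcoord c (Z p).

Definition nonneg_cone : cone_map M := fun p => [set v | v != 0 /\ 0 <= f v].
Arguments nonneg_cone : clear implicits.

Let f0 p : f (0 : tangent p) = 0.
Proof. by rewrite -[0](scale0r 0) fZ// mul0r. Qed.

Let nonneg_coneU0 p (v : tangent p) : (nonneg_cone p `|` [set 0]) v <-> 0 <= f v.
Proof.
split=> [[[]//|->]|fv]; first by rewrite f0.
by have [->|v0] := eqVneq v 0; [right|left].
Qed.

Import VectorInternalTheory.

Let nonneg_cone_closed p : closed_cone (nonneg_cone p).
Proof.
pose c := some_chart p; have cp : chart_at c p := some_chartP p.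
(* [closed_cone] uses the coordinates [v2r], whereas continuity of [f] is known in charts. The two
   coordinate systems differ by a linear, hence continuous, map. *)
pose h (w : 'rV[R]_(dim (tangent p))) :=
  f (chart_vect c p (tcoord c (r2v w : tangent p))).
have hE w : h w = f (r2v w : tangent p).
  by rewrite /h tcoordK.
exists (h @^-1` [set r | 0 <= r]).
  apply: closed_comp; last exact: closed_ge.
  move=> w _.
  have cw : tcoord c (r2v u : tangent p) @[u --> w] -->
      tcoord c (r2v w : tangent p).
    apply: (@cvg_linear R _ (nbhs w) _ _ _
      (fun u => tcoord c (r2v u : tangent p)) id w _ (@cvg_id _ _)).
    by move=> a u v; rewrite !linearP.
  apply: (@fibre_cvg _ _ _ f _ (nbhs w) _ c (fun=> p) p _ _ f_cont cp _ cw).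
  exact: cvg_cst.
apply/seteqP; split=> v.
  move=> [v0 fv]; split; last by move/eqP: v0.
  by rewrite /= hE v2rK.
by rewrite /= hE v2rK => -[fv /eqP v0].
Qed.

Lemma nonneg_cone_structure : cone_structure nonneg_cone.
Proof.
move=> p; split.
- exists (Z p); split; last exact: ltW.
  by apply/eqP => Z0; have := fZ_gt0 p; rewrite Z0 f0 ltxx.
- exact: nonneg_cone_closed.
- move=> v v0 line; have := fDN v0; apply/negP; rewrite -leNgt addr_ge0//.
    by apply/nonneg_coneU0; rewrite -[v]scale1r; exact: line.
  by apply/nonneg_coneU0; rewrite -scaleN1r; exact: line.
- split; first by move=> [/eqP].
  + apply/convex_setW => u v /set_mem[u0 fu] /set_mem[v0 fv] t t0 t1.
    rewrite inE /nonneg_cone /=.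
    rewrite -[conv t u v]/(t%:num *: (u : tangent p) + (1 - t%:num) *: (v : tangent p)).
    have s0 : 0 < 1 - t%:num by rewrite subr_gt0.
    have fsum := fD (t%:num *: (u : tangent p)) ((1 - t%:num) *: (v : tangent p)).
    have tu0 : 0 <= f (t%:num *: (u : tangent p)).
      by rewrite fZ; [exact: mulr_ge0 (ltW t0) fu|exact: ltW].
    have tv0 : 0 <= f ((1 - t%:num) *: (v : tangent p)).
      by rewrite fZ; [exact: mulr_ge0 (ltW s0) fv|exact: ltW].
    split; last by apply: le_trans fsum; exact: addr_ge0.
    (* If the combination vanished, its two summands would be opposite nonzero vectors with [f]
       nonnegative on both, against [fDN]. *)
    apply/negP; rewrite addr_eq0 => /eqP uv.
    have := @fDN p ((1 - t%:num) *: (v : tangent p)).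
    rewrite -uv scaler_eq0 negb_or gt_eqF//= => /(_ v0); apply/negP.
    by rewrite -leNgt addr_ge0.
  + move=> v s [v0 fv] s0; split; first by rewrite scaler_eq0 negb_or gt_eqF.
    by rewrite fZ; [exact: mulr_ge0 (ltW s0) fv|exact: ltW].
Qed.

Lemma open_fibre_preimage (O : set R) : open O ->
  open [set z : tangent_bundle M | O (f (tvec z))].
Proof.
move=> oO; apply: open_tangent_bundle => c [p v] /= cp Ov.
apply: (f_cont (w := tcoord c v) cp); rewrite tcoordK//.
exact: open_nbhs_nbhs.
Qed.

(** The set [f >= 0] is closed in the bundle. The set [f > 0] is open, contains the values of [Z],
    and misses the zero section because [f] vanishes there. *)
Lemma nonneg_cone_proper : proper_cone_structure nonneg_cone.
Proof.
split; [split; first exact: nonneg_cone_structure|].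
  exists [set z : tangent_bundle M | 0 <= f (tvec z)].
    rewrite (_ : mkset _ = ~` [set z | f (tvec z) < 0]).
      by apply: open_closedC; exact: (open_fibre_preimage (@open_lt R 0)).
    by apply/seteqP; split=> z /=; rewrite leNgt => /negP.
  by apply/seteqP; split=> z [? ?]; split.
move=> p; exists (Z p).
have nA : nbhs (TangentVector (Z p)) [set z : tangent_bundle M | 0 < f (tvec z)].
  apply: open_nbhs_nbhs; split; last exact: fZ_gt0.
  exact: (open_fibre_preimage (@open_gt R 0)).
apply: filterS nA => -[q v] /= fv.
split; last exact: ltW.
by apply/eqP => /= v0; rewrite v0 f0 ltxx in fv.
Qed.

Let local_coneE c p w : chart_at c p ->
  local_cone nonneg_cone c p w <-> 0 <= f (chart_vect c p w) /\ euclidean_ball w.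
Proof.
move=> cp; split=> [[[v vC <-] bw]|[fw bw]]; split => //.
  by rewrite tcoordK//; exact/nonneg_coneU0.
exists (chart_vect c p w); last exact: chart_vectK.
exact/nonneg_coneU0.
Qed.

(** A point [w] of the ball either lies in the cone at [p0], hence in the interior of [V], or has
    [f < 0] on a neighbourhood of [(p0, w)]. Compactness of the ball yields one neighbourhood of
    [p0] that serves all [w]. *)
Lemma nonneg_cone_usc c : atlas c ->
  upper_semicontinuous_in c (local_cone nonneg_cone c).
Proof.
move=> ca p0 cp0 V FV; have cp : chart_at c p0 by split.
have /compact_near_coveringP cov := @euclidean_ball_compact R n.
have : \forall p \near p0, @euclidean_ball R n `<=`
    (fun w => local_cone nonneg_cone c p w -> V w).
  apply: cov => w bw.
  have [fw|fw] := leP 0 (f (chart_vect c p0 w)).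
    have Vw : nbhs w V by apply: FV; apply/local_coneE.
    exists (V, setT); first by split => //; exact: filterT.
    by move=> [w' p] [/= Vw' _] _.
  have fneg : \forall y \near (p0, w), f (chart_vect c y.1 y.2) < 0.
    exact: (cvgr_lt _ (f_cont (w := w) cp)).
  have [[N1 N2] /= [n1 n2] sN] := filterI fneg (near_fst w (near_chart_at cp)).
  exists (N2, N1) => //= -[w' p] /= [w'N pN].
  have [/= fw' cp'] := sN (p, w') (conj pN w'N).
  by move=> /(local_coneE _ cp')[]; rewrite leNgt fw'.
apply: filterS => p bV w lw; apply: (bV w) => //.
by case: lw.
Qed.

Lemma nonneg_cone_lsc c : atlas c ->
  lower_semicontinuous_in c (local_cone nonneg_cone c).
Proof.
move=> ca p0 p cp0 cp pp0 y0.
have c0 : chart_at c p0 by split.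
have ck k : chart_at c (p k) by split.
move=> /(local_coneE _ c0)[fy0 by0].
(* Adding [eps k *: Z] brings [y0] into the cone at [p k] by superadditivity, and
   dividing by [nrm] brings it back into the ball. *)
pose phi k := f (chart_vect c (p k) y0).
(* The numerator is twice the negative part of [phi k], so superadditivity gives
   [f (v k) >= |phi k|]; it tends to 0 since [phi] tends to [f] at [y0], which is nonnegative. *)
pose eps k := (`|phi k| - phi k) / f (Z (p k)).
pose v k := chart_vect c (p k) y0 + eps k *: Z (p k).
(* The maximum with 1 leaves vectors of the ball unchanged, so [nrm y0 = 1] and the rescaling
   disappears in the limit. *)
pose nrm (w : 'rV[R]_n) := Num.sqrt (Num.max 1 (\sum_i w 0 i ^+ 2)).
pose y k := (nrm (tcoord c (v k)))^-1 *: tcoord c (v k).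
have nrm_gt0 w : 0 < nrm w by rewrite sqrtr_gt0 lt_max ltr01.
have f_cvg (w : nat -> 'rV[R]_n) w0 : w @ \oo --> w0 ->
    f (chart_vect c (p k) (w k)) @[k --> \oo] --> f (chart_vect c p0 w0).
  by move=> cw; exact: (@fibre_cvg _ _ _ f _ \oo _ c p p0 _ _ f_cont c0 pp0 cw).
have Zp : tcoord c (Z (p k)) @[k --> \oo] --> tcoord c (Z p0).
  exact: (cvg_comp p (fun q => tcoord c (Z q)) pp0 (Z_cont c0)).
have eps_cvg : eps @ \oo --> (0 : R).
  rewrite -[X in _ --> X](mul0r (f (Z p0))^-1).
  apply: cvgM.
    have phi_cvg : phi @ \oo --> f (chart_vect c p0 y0).
      by apply: f_cvg; exact: cvg_cst.
    rewrite -(subrr (f (chart_vect c p0 y0))) -[X in X - _]ger0_norm//.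
    by apply: cvgB => //; exact: cvg_norm.
  apply: cvgV; first by rewrite gt_eqF.
  have := f_cvg _ _ Zp; rewrite tcoordK//; apply: cvg_trans.
  by apply: near_eq_cvg; near=> k; rewrite tcoordK.
have v_cvg : tcoord c (v k) @[k --> \oo] --> y0.
  apply: (@cvg_congr _ _ _ _ 
    (fun k => y0 + eps k *: tcoord c (Z (p k))) _ (y0 + 0 *: tcoord c (Z p0))).
  - by move=> k; rewrite /v linearD linearZ/= chart_vectK.
  - by rewrite scale0r addr0.
  - by apply: cvgD; [exact: cvg_cst|exact: cvgZ].
exists y.
  move=> k; apply/(local_coneE _ (ck k)); split.
    have -> : chart_vect c (p k) (y k) = (nrm (tcoord c (v k)))^-1 *: v k.
      by apply: (tcoord_inj (ck k)); rewrite chart_vectK// linearZ.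
    have nrm_ge0 : 0 <= (nrm (tcoord c (v k)))^-1 by rewrite invr_ge0 ltW.
    rewrite fZ//; apply: mulr_ge0 => //.
    apply: le_trans (fD _ _).
    rewrite fZ; last by apply: divr_ge0; [rewrite subr_ge0 ler_norm|exact: ltW].
    by rewrite divfK ?gt_eqF// -/(phi k) addrC subrK.
  rewrite /euclidean_ball /=.
  under eq_bigr do rewrite mxE exprMn.
  rewrite -mulr_sumr exprVn sqr_sqrtr ?le_max ?ler01// mulrC ler_pdivrMr.
    by rewrite mul1r le_max lexx orbT.
  by rewrite lt_max ltr01.
have sq_cvg : \sum_i tcoord c (v k) 0 i ^+ 2 @[k --> \oo] --> \sum_i y0 0 i ^+ 2.
  by refine (cvg_sqr_sum v_cvg).
have max_cvg : Num.max 1 (\sum_i tcoord c (v k) 0 i ^+ 2) @[k --> \oo] -->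
    Num.max 1 (\sum_i y0 0 i ^+ 2).
  apply: (cvg_comp _ (fun r : R => Num.max 1 r) sq_cvg).
  by apply: (@continuous_max R R (cst 1) id); [exact: cvg_cst|exact: cvg_id].
have nrm_cvg : nrm (tcoord c (v k)) @[k --> \oo] --> nrm y0.
  by apply: (cvg_comp _ Num.sqrt max_cvg); exact: sqrt_continuous.
have nrmy0 : nrm y0 = 1 by rewrite /nrm max_l// sqrtr1.
apply: (@cvg_congr _ 'rV[R]_n \oo _ y _ ((nrm y0)^-1 *: y0)) => //.
  by rewrite nrmy0 invr1 scale1r.
by apply: cvgZ => //; apply: cvgV; rewrite ?gt_eqF.
Unshelve. all: by end_near. Qed.

Lemma nonneg_cone_continuous : continuous_cone_structure nonneg_cone.
Proof. by move=> c ca; split; [exact: nonneg_cone_usc|exact: nonneg_cone_lsc]. Qed.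

End FunctionCone.

(** * The cone function of a spacetime *)

Section ConeOfSpacetime.
Variables (R : realType) (n nu : nat) (M : manifold R n).

Lemma cvg_mform (g : metric M) (T : Type) (F : set_system T) {FF : Filter F} c
    (p : T -> M) p0 (U V : forall t, tangent (p t)) (U0 V0 : tangent p0) :
  chart_at c p0 -> p @ F --> p0 ->
  tcoord c (U t) @[t --> F] --> tcoord c U0 ->
  tcoord c (V t) @[t --> F] --> tcoord c V0 ->
  mform g (U t) (V t) @[t --> F] --> mform g U0 V0.
Proof.
move=> c0 pp UU VV; have [G Gs gE] := mform_smooth g c0.1.
have GG : G (cmap c (p t)) @[t --> F] --> G (cmap c p0).
  have cp : cmap c (p t) @[t --> F] --> cmap c p0.
    exact: (cvg_comp p (cmap c) pp (cmap_cvg c0)).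
  apply: (cvg_comp _ G cp); apply: (Gs 0%N).
  by exists p0 => //; exact: c0.2.
have near_c : \forall t \near F, cdom c (p t).
  by have := pp _ (near_chart_at c0); apply: filterS => t [].
rewrite (gE _ c0.2) mxE; apply: cvg_trans.
  apply: (@near_eq_cvg _ _ _ _ (fun t => \sum_j
    (\sum_i tcoord c (U t) 0 i * G (cmap c (p t)) i j) * tcoord c (V t) 0 j)).
  apply: filterS near_c => t ct; rewrite (gE _ ct) mxE; apply: eq_bigr => j _.
  by rewrite !mxE.
apply: cvg_sum => j _; rewrite !mxE; apply: cvgM; last exact: (cvg_coord VV).
apply: cvg_sum => i _; apply: cvgM; first exact: (cvg_coord UU).
exact: (cvg_coord GG).
Qed.

Implicit Type s : seq (vector_field M).

Definition field_tuple s p : (size s).-tuple (tangent p) :=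
  map_tuple (fun Y : vector_field M => Y p) (in_tuple s).

Definition field_cone_fun (g : metric M) s p (v : tangent p) : R :=
  cone_fun (@mform _ _ _ g p) (field_tuple s p) v.

Lemma field_tuple_nth s p i : (field_tuple s p)`_i = nth (fun=> 0) s i p.
Proof.
have [si|si] := ltnP i (size s); first by rewrite (nth_map (fun=> 0)).
by rewrite !nth_default// size_map.
Qed.

Variable S : spacetime M nu.
Hypothesis nu_gt0 : (0 < nu)%N.
Let s := enum_fset (sfields S).
Let g := smetric S.

Let s_size : size s = nu. Proof. by rewrite -(sfields_card S). Qed.

Let s_span p : <<field_tuple s p>>%VS = field_span (sfields S) p.
Proof. by []. Qed.

(** There are [nu] fields and their span has dimension [nu], so their values are independent at
    every point. *)
Let s_free p : free (field_tuple s p).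
Proof. by rewrite /free s_span sfields_dim size_tuple s_size. Qed.

Let s_neg p (v : tangent p) :
  v \in <<field_tuple s p>>%VS -> v != 0 -> mform g v v < 0.
Proof. exact: sfields_negative. Qed.

Let s_max p (W : {vspace tangent p}) :
  (forall v, v \in W -> v != 0 -> mform g v v < 0) -> (\dim W <= size s)%N.
Proof. by rewrite s_size; have [_] := smetric_index S p; apply. Qed.

Lemma field_gram_unit p : gram (@mform _ _ _ g p) (field_tuple s p) \in unitmx.
Proof.
exact: (gram_unit (@mform_linear _ _ _ g p) (@mform_sym _ _ _ g p) (s_free p)
  (@s_neg p)).
Qed.

(** By [gram_proj_norm] the function is built by sums, products and a square root from g(v, v), the
    g(v, X_i), g(X_0, X_0) and the inverse Gram matrix, each continuous in charts. *)
Lemma field_cone_fun_continuous : fibre_continuous (field_cone_fun g s).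
Proof.
move=> c p0 w0 c0.
pose X i := nth (fun=> 0) s i : vector_field M.
pose V (y : M * 'rV[R]_n) := chart_vect c y.1 y.2.
have VV : tcoord c (V y) @[y --> (p0, w0)] --> tcoord c (chart_vect c p0 w0).
  have sn : y.2 @[y --> (p0, w0)] --> w0 by exact: cvg_snd.
  rewrite chart_vectK//; apply: cvg_trans sn.
  apply: near_eq_cvg; have := near_fst w0 (near_chart_at c0).
  by apply: filterS => y cy; rewrite chart_vectK.
have fp : fst @ (p0, w0) --> p0 by exact: cvg_fst.
have XX i : (i < size s)%N ->
    tcoord c (X i y.1) @[y --> (p0, w0)] --> tcoord c (X i p0).
  move=> si; apply: (cvg_comp_fst (h := fun q => tcoord c (X i q))).
  by apply: field_cvg => //; exact/sfields_continuous/mem_nth.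
have gVX i : (i < size s)%N -> mform g (V y) (X i y.1) @[y --> (p0, w0)] -->
    mform g (chart_vect c p0 w0) (X i p0).
  by move=> si; apply: (cvg_mform c0 fp VV); exact: XX.
have gVV : mform g (V y) (V y) @[y --> (p0, w0)] -->
    mform g (chart_vect c p0 w0) (chart_vect c p0 w0).
  exact: (cvg_mform c0 fp VV VV).
have gXX i j : (i < size s)%N -> (j < size s)%N ->
    mform g (X i y.1) (X j y.1) @[y --> (p0, w0)] --> mform g (X i p0) (X j p0).
  by move=> si sj; apply: (cvg_mform c0 fp); exact: XX.
have invXX i j : invmx (gram (@mform _ _ _ g y.1) (field_tuple s y.1)) i j
    @[y --> (p0, w0)] --> invmx (gram (@mform _ _ _ g p0) (field_tuple s p0)) i j.
  apply: cvg_invmx => [y||k l]; try exact: field_gram_unit.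
  rewrite mxE !field_tuple_nth; apply: (cvg_congr _ _ (gXX k l _ _)) => //.
  by move=> y; rewrite mxE !field_tuple_nth.
have s0 : (0 < size s)%N by rewrite s_size.
have E p (v : tangent p) : field_cone_fun g s v =
    - 2 * mform g v (X 0%N p) - Num.sqrt (- mform g (X 0%N p) (X 0%N p) *
      (mform g v v - 2 * \sum_(i < size s) (\sum_(j < size s) mform g v (X j p) *
        invmx (gram (@mform _ _ _ g p) (field_tuple s p)) j i) *
          mform g v (X i p))).
  rewrite /field_cone_fun /cone_fun /flip_form.
  rewrite (gram_proj_norm (@mform_linear _ _ _ g p) (@mform_sym _ _ _ g p)
    (s_free p) (@s_neg p)) !field_tuple_nth.
  congr (_ - Num.sqrt (_ * (_ - _ * _))); apply: eq_bigr => i _.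
  rewrite field_tuple_nth; congr (_ * _).
  by apply: eq_bigr => j _; rewrite field_tuple_nth.
apply: (cvg_congr (fun y => E _ _) (E _ _)).
apply: cvgB; first by apply: cvgM; [exact: cvg_cst|exact: gVX].
apply: (cvg_comp _ Num.sqrt); last exact: sqrt_continuous.
apply: cvgM; first by apply: cvgN; exact: gXX.
apply: cvgB => //; apply: cvgM; first exact: cvg_cst.
apply: cvg_sum => i _; apply: cvgM; last exact: gVX.
by apply: cvg_sum => j _; apply: cvgM; [exact: gVX|exact: invXX].
Qed.

Lemma field_cone_proper_continuous :
  proper_cone_structure (nonneg_cone (field_cone_fun g s)) /\
  continuous_cone_structure (nonneg_cone (field_cone_fun g s)).
Proof.
have s0 : (0 < size s)%N by rewrite s_size.
pose l p := @mform_linear _ _ _ g p; pose sy p := @mform_sym _ _ _ g p.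
pose nd p := @mform_nondegenerate _ _ _ g p.
have fD p (u v : tangent p) : field_cone_fun g s u + field_cone_fun g s v <=
    field_cone_fun g s (u + v).
  exact: (cone_funD (l p) (sy p) (s_free p) (@s_neg p) (@s_max p) (nd p) s0).
have fZ p a (v : tangent p) : 0 <= a ->
    field_cone_fun g s (a *: v) = a * field_cone_fun g s v.
  exact: (cone_funZ (field_tuple s p) (l p) (sy p) v).
have fN p (v : tangent p) : v != 0 ->
    field_cone_fun g s v + field_cone_fun g s (- v) < 0.
  exact: (cone_funDN (l p) (sy p) (s_free p) (@s_neg p) (@s_max p) (nd p) s0).
have fX p : 0 < field_cone_fun g s (field_tuple s p)`_0.
  exact: (cone_fun_head_gt0 (l p) (sy p) (s_free p) (@s_neg p) s0).
pose Z p := (field_tuple s p)`_0.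
have Zc c p : chart_at c p -> tcoord c (Z q) @[q --> p] --> tcoord c (Z p).
  move=> cp; rewrite /Z; under eq_fun do rewrite field_tuple_nth.
  rewrite field_tuple_nth; apply: field_cvg => //.
  exact/sfields_continuous/mem_nth.
split.
  exact: (nonneg_cone_proper fD fZ fN fX field_cone_fun_continuous).
exact: (nonneg_cone_continuous fD fZ fX field_cone_fun_continuous Zc).
Qed.

End ConeOfSpacetime.

Theorem theorem1p5 (R : realType) (n nu : nat) (M : manifold R n)
    (hnu : (0 < nu <= n)%N) :
  exists C : spacetime M nu -> cone_map M,
    (forall S : spacetime M nu,
       proper_cone_structure (C S) /\ continuous_cone_structure (C S)) /\
    conformally_invariant C.
Proof.
have [nu0 _] := andP hnu.
(* The distinguished field is the head of the enumeration of the set of fields. It is determined by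
   that set alone, so spacetimes with equal [sfields] use the same one. *)
exists (fun S => nonneg_cone (field_cone_fun (smetric S) (enum_fset (sfields S)))).
split=> [S|S T ST [Om [_ Om0 OmE]]]; first exact: field_cone_proper_continuous.
apply: functional_extensionality_dep => p; apply/seteqP.
rewrite -ST.
have E (v : tangent p) : field_cone_fun (smetric T) (enum_fset (sfields S)) v =
    Om p * field_cone_fun (smetric S) (enum_fset (sfields S)) v.
  apply: cone_fun_scale => //; exact: field_gram_unit.
by split=> v [v0 fv]; split; move: fv; rewrite // E pmulr_rge0.
Qed.
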